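(* Let $R$ be an associative ring with identity and let $M$ be a regular right $R$-module. Then the minus order $\leq^{-}$ is a partial order on $M$ (i.e. it is reflexive, antisymmetric and transitive).
   Context: Rings are associative with identity, and modules are unitary right modules. For a right $R$-module $M$, let $S=\mathrm{End}_R(M)$ and $M^*=\mathrm{Hom}_R(M,R)$. For $m\in M$ and $\varphi\in M^*$, write $\varphi m:=\varphi(m)\in R$, and let $m\varphi\in S$ denote the endomorphism $x\mapsto m\,\varphi(x)$ of $M$. An element $m\in M$ is (Zelmanowitz) regular if $m=m\varphi m$, i.e. $m=m\,\varphi(m)$, for some $\varphi\in M^*$. The module $M$ is regular if every element of $M$ is regular. Minus order: for $m_1,m_2\in M$, $m_1\leq^{-}m_2$ means that there exists $\varphi\in M^*$ such that $m_1=m_1\varphi m_1$, $m_1\varphi=m_2\varphi$ (as elements of $S$), and $\varphi m_1=\varphi m_2$ (in $R$). *)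

(* Defs.v *)
From HB Require Import structures.
From mathcomp Require Import all_boot all_algebra.

Set Implicit Arguments.
Unset Strict Implicit.
Unset Printing Implicit Defensive.

Import GRing.Theory.
Local Open Scope ring_scope.

(* A right R-module is a left module over the converse ring R^c; the scalar
   action r *: m is then the right action m r. *)
Definition ract (R : pzRingType) (M : lmodType R^c) (m : M) (r : R) : M :=
  (r : R^c) *: m.

(* M^* = Hom_R(M, R): the regular module (R^c)^o is R acting on itself by
   right multiplication, r *: x being the product x r in R. *)
Definition dual (R : pzRingType) (M : lmodType R^c) : Type :=
  {linear M -> (R^c)^o}.

Definition dual_eval (R : pzRingType) (M : lmodType R^c)
  (phi : dual M) (m : M) : R := phi m.

Section DualEnd.
Variables (R : pzRingType) (M : lmodType R^c) (m : M) (phi : dual M).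

Definition dual_end_fun (x : M) : M := ract m (dual_eval phi x).

Lemma dual_end_fun_is_linear : linear dual_end_fun.
Proof.
by move=> a x y; rewrite /dual_end_fun /ract /dual_eval linearP scalerDl scalerA.
Qed.

HB.instance Definition _ :=
  GRing.isLinear.Build R^c M M _ dual_end_fun dual_end_fun_is_linear.

Definition dual_end : {linear M -> M} := dual_end_fun.
End DualEnd.

Lemma ract_mul (R : pzRingType) (M : lmodType R^c) (m : M) (r s : R) :
  ract m (r * s) = ract (ract m r) s.
Proof. by rewrite /ract scalerA. Qed.

Lemma dual_eval_ract (R : pzRingType) (M : lmodType R^c)
  (phi : dual M) (m : M) (r : R) :
  dual_eval phi (ract m r) = dual_eval phi m * r.
Proof. by rewrite /dual_eval /ract linearZ. Qed.

Definition regular_elt (R : pzRingType) (M : lmodType R^c) (m : M) : Prop :=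
  exists phi : dual M, m = ract m (dual_eval phi m).

Definition regular_module (R : pzRingType) (M : lmodType R^c) : Prop :=
  forall m : M, regular_elt m.

Definition minus_le (R : pzRingType) (M : lmodType R^c) (m1 m2 : M) : Prop :=
  exists phi : dual M,
    [/\ m1 = ract m1 (dual_eval phi m1),
        dual_end m1 phi =1 dual_end m2 phi
      & dual_eval phi m1 = dual_eval phi m2].

(* Main.v *)
(** Antisymmetry: if [a = a φ a], [φ a = φ b] and [b = a (ψ b)], then
    [a = a (φ b) = a (φ a) (ψ b) = a (ψ b) = b].

    Transitivity: let [φ] witness [a <= b] and [ψ] witness [b <= c].  Since
    [a = b (φ a) = a (φ b)], one gets [a (ψ b) = a (ψ a) = b (ψ a) = a], and
    then [x |-> ψ a * ψ x] witnesses [a <= c]. *)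
Require Import Defs.
From Stdlib Require Relation_Definitions.
From HB Require Import structures.
From mathcomp Require Import all_boot all_algebra.

Set Implicit Arguments.
Unset Strict Implicit.
Unset Printing Implicit Defensive.

Import GRing.Theory.
Local Open Scope ring_scope.

(** Left multiplication by [r] commutes with the right action of [R] on itself, so [M^*] is a left
    [R]-module. This supplies the witness for transitivity. *)
Lemma dual_lmul_exists (R : pzRingType) (M : lmodType R^c) (r : R)
    (psi : dual M) :
  exists chi : dual M, forall x, dual_eval chi x = r * dual_eval psi x.
Proof.
pose f (x : M) : (R^c)^o := (r * dual_eval psi x : R).
have f_lin : linear f.
  move=> k x y; rewrite /f [dual_eval psi (_ + _)]linearP.
  (* Scaling by [k] in [(R^c)^o] unfolds to right multiplication by [k] in [R]. *)
  transitivity (r * (dual_eval psi x * (k : R) + dual_eval psi y)) => //.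
  by rewrite mulrDr mulrA.
pose chi := GRing.isLinear.Build R^c M (R^c)^o *:%R f f_lin.
pose g : dual M := HB.pack f chi.
by exists g.
Qed.

Lemma minus_le_refl (R : pzRingType) (M : lmodType R^c) (m : M) :
  regular_elt m -> minus_le m m.
Proof. by case=> phi m_reg; exists phi. Qed.

Lemma minus_le_anti (R : pzRingType) (M : lmodType R^c) (a b : M) :
  minus_le a b -> minus_le b a -> a = b.
Proof.
case=> phi [a_reg _ phi_ab] [psi [b_reg psi_ba _]].
have b_a : b = ract a (dual_eval psi b).
  by rewrite {1}b_reg; exact: psi_ba.
by rewrite a_reg phi_ab [in dual_eval phi b]b_a dual_eval_ract ract_mul -a_reg.
Qed.

Lemma minus_le_trans (R : pzRingType) (M : lmodType R^c) (a b c : M) :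
  minus_le a b -> minus_le b c -> minus_le a c.
Proof.
case=> phi [a_reg phi_end phi_ab] [psi [b_reg psi_end psi_bc]].
have a_b : a = ract b (dual_eval phi a).
  by rewrite {1}a_reg; exact: phi_end.
have psi_a : dual_eval psi a = dual_eval psi b * dual_eval phi a.
  by rewrite {1}a_b dual_eval_ract.
(* [φ] absorbs the factor [ψ b]: [φ b * ψ b = φ (b (ψ b)) = φ b]. *)
have a_psib : ract a (dual_eval psi b) = a.
  by rewrite {1}a_reg phi_ab -ract_mul -dual_eval_ract -b_reg -phi_ab -a_reg.
have a_psia : ract a (dual_eval psi a) = a.
  by rewrite psi_a ract_mul a_psib -a_reg.
have b_psia : ract b (dual_eval psi a) = a.
  by rewrite psi_a ract_mul -b_reg -a_b.
have [chi chiE] := dual_lmul_exists (dual_eval psi a) psi.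
exists chi; split.
- by rewrite chiE ract_mul !a_psia.
- move=> x; rewrite /= /dual_end_fun chiE !ract_mul a_psia.
  (* [psi_end] at [a] gives [c (ψ a) = b (ψ a) = a]. *)
  by rewrite -[ract c _](psi_end a) /= /dual_end_fun b_psia.
(* Both sides equal [ψ a], since [ψ a * ψ a = ψ (a (ψ a))] and [ψ a * ψ b = ψ (a (ψ b))]. *)
- by rewrite !chiE -psi_bc -!dual_eval_ract a_psia a_psib.
Qed.

Theorem theorem2p6 (R : pzRingType) (M : lmodType R^c)
  (regM : regular_module M) :
  Relation_Definitions.order M (@minus_le R M).
Proof.
split.
- by move=> m; exact: minus_le_refl.
- by move=> a b c; exact: minus_le_trans.
- by move=> a b; exact: minus_le_anti.
Qed.
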